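(* For all integers $n \geq 0$, $|A_{2n+1}(2143)|$ is equal to the number of shifted standard Young tableaux of shape $\langle n+2, n+1, n\rangle$.
   Context: A permutation $w = w_1w_2\cdots w_m$ of length $m$ is a word containing each element of $[m]=\{1,\dots,m\}$ exactly once. It is alternating if $w_1 < w_2 > w_3 < w_4 > \cdots$ (up-down convention); $A_m$ is the set of alternating permutations of length $m$. A permutation $w$ contains the pattern $p = p_1 \cdots p_k \in S_k$ if there are indices $i_1 < \cdots < i_k$ such that $w_{i_\ell} < w_{i_r}$ if and only if $p_\ell < p_r$; otherwise $w$ avoids $p$. $A_m(p)$ is the set of elements of $A_m$ that avoid $p$. For a partition $\lambda = \langle \lambda_1, \lambda_2, \dots\rangle$ with distinct nonzero parts $\lambda_1 > \lambda_2 > \cdots$ (trailing zeroes are ignored), the shifted Young diagram of shape $\lambda$ is the array of boxes in positions (row $i$, column $j$) with $i \le j \le i + \lambda_i - 1$, i.e. row $i$ has $\lambda_i$ boxes and is shifted $i-1$ steps to the right. A shifted standard Young tableau of shape $\lambda$ is a filling of these boxes with $1, 2, \dots, |\lambda|$, where $|\lambda| = \lambda_1 + \lambda_2 + \cdots$, each used exactly once, with entries increasing from left to right along rows and from top to bottom down columns. $|S|$ denotes the size of the set $S$. *)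

(* Defs.v *)
From mathcomp Require Import all_boot all_fingroup.

Set Implicit Arguments.
Unset Strict Implicit.
Unset Printing Implicit Defensive.

(* A permutation w_1 ... w_m of [m] is an element w of 'S_m, with
   positions and values both shifted down by one: w i is w_(i+1) - 1. *)

(* Up-down: w_1 < w_2 > w_3 < ...; the ascents start at even 0-based positions. *)
Definition alternating (m : nat) (w : 'S_m) : bool :=
  [forall i : 'I_m, forall j : 'I_m,
     (j == i.+1 :> nat) ==> (if odd i then w j < w i else w i < w j)].

(* [f] lists the positions i_1 < ... < i_k of an occurrence of p in w. *)
Definition contains (m k : nat) (w : 'S_m) (p : 'S_k) : bool :=
  [exists f : {ffun 'I_k -> 'I_m},
     [forall l : 'I_k, forall r : 'I_k, (l < r) ==> (f l < f r)] &&
     [forall l : 'I_k, forall r : 'I_k, (w (f l) < w (f r)) == (p l < p r)]].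

Definition avoids (m k : nat) (w : 'S_m) (p : 'S_k) : bool := ~~ contains w p.

Definition alt_avoiding (m k : nat) (p : 'S_k) : {set 'S_m} :=
  [set w : 'S_m | alternating w && avoids w p].

Definition p2143 : 'S_4 :=
  (tperm (inord 0) (inord 1) * tperm (inord 2) (inord 3))%g.

Lemma p2143E : [seq (p2143 i).+1 | i : 'I_4] = [:: 2; 1; 4; 3].
Proof.
rewrite /image_mem (eq_map (g := fun i : 'I_4 => nth 0 [:: 2; 1; 4; 3] i)).
  by rewrite (map_comp (nth 0 _) val) val_enum_ord.
move=> i; rewrite permM.
have H (a b : 'I_4) : (a == b) = (val a == val b) by [].
by case: i => [[|[|[|[|//]]]] lti] /=;
   rewrite !permE /= !H /= !inordK //= !H /= !inordK.
Qed.

(* A shape is its list of row lengths. Box (i, k) is the k-th box of row i (both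
   0-based), so that it lies in column i + k; a zero part contributes no box. *)
Definition box (la : seq nat) : finType :=
  {i : 'I_(size la) & 'I_(nth 0 la i)}.

Definition box_row (la : seq nat) (b : box la) : nat := tag b.
Definition box_col (la : seq nat) (b : box la) : nat := tag b + tagged b.

(* Entries are 0, ..., |la| - 1 rather than 1, ..., |la|. *)
Definition is_shifted_SYT (la : seq nat) (T : {ffun box la -> 'I_(sumn la)}) :
    bool :=
  [&& [forall e : 'I_(sumn la), #|[set b | T b == e]| == 1],
      [forall b : box la, forall c : box la,
         (box_row b == box_row c) && (box_col b < box_col c) ==> (T b < T c)]
    & [forall b : box la, forall c : box la,
         (box_col b == box_col c) && (box_row b < box_row c) ==> (T b < T c)]].

Definition shifted_SYT (la : seq nat) : {set {ffun box la -> 'I_(sumn la)}} :=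
  [set T | is_shifted_SYT T].

(* Main.v *)
Require Import Defs.
From mathcomp Require Import all_boot all_fingroup zify.
(** Both sets are encoded by words to which one value at a time is appended,
    older values being shifted up to make room.  For a 2143-avoiding alternating
    word of odd length, let [t] be its least value that is followed by a smaller
    one, and [k] the number of values whose appending creates no 2143.  Appending
    an ascent and then a descent turns [(t, k)] into an arbitrary [(t', k')] with
    [1 <= t' <= t + 1] and [t + 3 <= k' <= k + 2].  A shifted tableau is
    read column by column from right to left, upwards in each column; the last
    full column is described by the ranks [x] and [y] of its middle and bottom
    entries, and a new column turns [(x, y)] into an arbitrary [(x', y')] with
    [1 <= x' <= x + 1] and [x' + 1 <= y' <= y + 2].  The two systems count the
    same sequences once [k] is delayed by one step: [x] is [t], and [y] is the
    next value of [k], minus 2.  The last choice of [t], which no [k] constrains,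
    is the position of the lone entry in row 2 of the second column. *)

Set Implicit Arguments.
Unset Strict Implicit.
Unset Printing Implicit Defensive.

(** * Permutations as words grown by appending a last value *)

Definition word m (w : 'S_m) : seq nat := [seq val (w i) | i <- enum 'I_m].

Definition append_value (c : nat) (s : seq nat) : seq nat := rcons (map (bump c) s) c.

Fixpoint extensions (a : seq nat -> nat -> bool) (r : nat) (s : seq nat) : nat :=
  if r is r'.+1 then
    \sum_(0 <= c < (size s).+1 | a s c) extensions a r' (append_value c s)
  else 1.

Lemma size_word m (w : 'S_m) : size (word w) = m.
Proof. by rewrite size_map size_enum_ord. Qed.

Lemma nth_word m (w : 'S_m) (i : 'I_m) : nth 0 (word w) i = w i.
Proof.
by rewrite (nth_map i) ?size_enum_ord // nth_ord_enum.
Qed.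

Lemma size_append c s : size (append_value c s) = (size s).+1.
Proof. by rewrite size_rcons size_map. Qed.

Lemma nth_append c s i : i < size s ->
  nth 0 (append_value c s) i = bump c (nth 0 s i).
Proof. by move=> lti; rewrite nth_rcons size_map lti (nth_map 0). Qed.

Lemma nth_append_last c s : nth 0 (append_value c s) (size s) = c.
Proof. by rewrite nth_rcons size_map ltnn eqxx. Qed.

Lemma word_lift_perm m (w : 'S_m) (c : 'I_m.+1) :
  word (lift_perm ord_max c w) = append_value c (word w).
Proof.
rewrite /word /append_value enum_ordSr map_rcons lift_perm_id -!map_comp.
congr (rcons _ _).
apply: eq_map => i /=.
have -> : widen_ord (leqnSn m) i = lift ord_max i.
  by apply: val_inj; rewrite /= /bump leqNgt ltn_ord.
by rewrite lift_perm_lift.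
Qed.

Lemma lift_perm_inj m : injective (fun p : 'S_m * 'I_m.+1 => lift_perm ord_max p.2 p.1).
Proof.
move=> [w c] [v d] /= e.
have cd : c = d by rewrite -(lift_perm_id ord_max c w) e lift_perm_id.
subst d; congr pair; apply/permP=> i; apply: (@lift_inj _ c).
by rewrite -2!(lift_perm_lift ord_max) e.
Qed.

(** A permutation of length [m.+1] amounts to a shorter one together with its last value [c]; as the
    cardinals agree, injectivity suffices. *)
Lemma sum_lift_perm m (P : pred 'S_m.+1) (F : 'S_m.+1 -> nat) :
  \sum_(w | P w) F w =
  \sum_(w : 'S_m) \sum_(c < m.+1 | P (lift_perm ord_max c w)) F (lift_perm ord_max c w).
Proof.
have bij : bijective (fun p : 'S_m * 'I_m.+1 => lift_perm ord_max p.2 p.1).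
  apply: inj_card_bij; first exact: lift_perm_inj.
  by rewrite card_prod card_ord !card_Sn factS mulnC.
by rewrite (reindex _ (onW_bij _ bij)) pair_big_dep.
Qed.

Lemma card_extensions (good : forall m, pred 'S_m) (a : seq nat -> nat -> bool) :
    (forall w : 'S_0, good 0 w) ->
    (forall m (w : 'S_m) (c : 'I_m.+1),
       good m.+1 (lift_perm ord_max c w) = good m w && a (word w) c) ->
  forall n, #|[set w | good n w]| = extensions a n [::].
Proof.
move=> good0 goodS n.
(* The good words of length [m], each weighted by its number of extensions to length [n], have the
   same total for every [m]; [m = 0] leaves only the empty word. *)
suff H r : forall m, r + m = n ->
    \sum_(w : 'S_m | good m w) extensions a r (word w) = #|[set w | good n w]|.
  rewrite -(H n 0 (addn0 n)) (eq_bigl xpredT) // (bigD1 1%g) //= big1.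
    by rewrite addn0 (size0nil (size_word _)).
  move=> w /eqP[]; apply/permP; by case.
elim: r => [|r IH] m; first by move=> <-; rewrite sum1dep_card add0n.
rewrite addSnnS => /IH <-; rewrite sum_lift_perm.
rewrite [RHS](bigID (good m)) /= [X in _ + X]big1 ?addn0 => [|w /negPf bad].
  apply: eq_bigr => w gw /=; rewrite size_word big_mkord.
  apply: eq_big => c; first by rewrite goodS gw.
  by rewrite word_lift_perm.
by rewrite big_pred0 // => c; rewrite goodS bad.
Qed.

(** * Appending a value to a 2143-avoiding alternating word *)

Definition alternating_word (s : seq nat) : Prop :=
  forall i, i.+1 < size s ->
    if odd i then nth 0 s i.+1 < nth 0 s i else nth 0 s i < nth 0 s i.+1.

Definition has2143 (s : seq nat) : Prop :=
  exists i j k l, [/\ i < j, j < k, k < l & l < size s] /\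
    [/\ nth 0 s j < nth 0 s i, nth 0 s i < nth 0 s l & nth 0 s l < nth 0 s k].

Lemma alternatingP m (w : 'S_m) : reflect (alternating_word (word w)) (alternating w).
Proof.
apply: (iffP forallP) => [alt i | alt i].
  rewrite size_word => ltim; have lti := ltnW ltim.
  have /forallP/(_ (Ordinal ltim))/implyP := alt (Ordinal lti).
  by rewrite -(nth_word w (Ordinal lti)) -(nth_word w (Ordinal ltim)); apply.
apply/forallP=> j; apply/implyP=> /eqP ji.
have := alt i; rewrite size_word -ji !nth_word; exact.
Qed.

Lemma p2143_nth (i : 'I_4) : p2143 i = nth 0 [:: 1; 0; 3; 2] i :> nat.
Proof.
have : nth 0 [seq (p2143 i).+1 | i : 'I_4] i = (p2143 i).+1.
  by rewrite (nth_map i) ?size_enum_ord // nth_ord_enum.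
by rewrite p2143E; case: i => [[|[|[|[|]]]] ?] //= [].
Qed.

Lemma containsP m (w : 'S_m) : reflect (has2143 (word w)) (contains w p2143).
Proof.
apply: (iffP existsP) => [[f /andP[/forallP f_lt /forallP f_w]] | [i [j [k [l [[ij jk kl]]]]]]].
  have lt (a b : 'I_4) : a < b -> f a < f b.
    by move=> ab; have /forallP/(_ b)/implyP/(_ ab) := f_lt a.
  have ww (a b : 'I_4) : (w (f a) < w (f b)) = (p2143 a < p2143 b).
    by have /forallP/(_ b)/eqP := f_w a.
  pose o k : 'I_4 := inord k.
  have oE k : k < 4 -> o k = k :> nat by move=> ?; rewrite inordK.
  exists (f (o 0)), (f (o 1)), (f (o 2)), (f (o 3)); rewrite size_word ltn_ord.
  split; first by split=> //; apply: lt; rewrite !oE.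
  by rewrite !nth_word !ww !p2143_nth !oE.
rewrite size_word => lm [wji wil wlk].
have km := ltn_trans kl lm; have jm := ltn_trans jk km; have im := ltn_trans ij jm.
pose f := [ffun a : 'I_4 => nth (Ordinal im)
  [:: Ordinal im; Ordinal jm; Ordinal km; Ordinal lm] a].
have wE p (pm : p < m) : w (Ordinal pm) = nth 0 (word w) p :> nat.
  by rewrite -nth_word.
exists f; apply/andP; split; apply/forallP=> a; apply/forallP=> b.
  apply/implyP; rewrite !ffunE.
  by move: a b => [[|[|[|[|?]]]] ?] [[|[|[|[|?]]]] ?] //= _; lia.
rewrite !ffunE !p2143_nth.
by move: a b => [[|[|[|[|?]]]] ?] [[|[|[|[|?]]]] ?] //=; rewrite !wE; lia.
Qed.

(* Appending [x] puts it below every old value [>= x]: a new 2143 consists of an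
   old 213 with [x] in the role of 3. *)
Definition open_slot (s : seq nat) (x : nat) : bool :=
  ~~ [exists i : 'I_(size s), exists j : 'I_(size s), exists k : 'I_(size s),
        [&& i < j, j < k, nth 0 s j < nth 0 s i, nth 0 s i < x & x <= nth 0 s k]].

Lemma open_slotP s x : reflect
  (forall i j k, i < j -> j < k -> k < size s -> nth 0 s j < nth 0 s i ->
     nth 0 s i < x -> nth 0 s k < x) (open_slot s x).
Proof.
apply: (iffP idP) => [/existsPn H i j k ij jk km ji ix | H].
  have jm := ltn_trans jk km; have im := ltn_trans ij jm.
  have /existsPn/(_ (Ordinal jm))/existsPn/(_ (Ordinal km)) := H (Ordinal im).
  by rewrite /= ij jk ji ix /= -ltnNge.
apply/existsP=> -[i /existsP[j /existsP[k /and5P[ij jk ji ix]]]].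
by rewrite leqNgt (H i j k).
Qed.

(** A descent may take [c] equal to the last entry, since that entry is then shifted above [c]; an
    ascent must exceed it strictly. *)
Definition alternating_step (s : seq nat) (c : nat) : bool :=
  [|| size s == 0 | if odd (size s).-1 then c <= nth 0 s (size s).-1
                    else nth 0 s (size s).-1 < c].

Definition step2143 (s : seq nat) (c : nat) : bool :=
  alternating_step s c && open_slot s c.

Lemma alternating_append s c :
  alternating_word (append_value c s) <-> alternating_word s /\ alternating_step s c.
Proof.
rewrite /alternating_word /alternating_step size_append.
case: (posnP (size s)) => [->|sz]; first by split.
split=> [alt | [alt st] i].
  split=> [i ltim|].
    have := alt i; rewrite !nth_append //; last exact: ltnW.
    by rewrite /bump; case: ifP; lia.
  have := alt (size s).-1; rewrite prednK // nth_append_last nth_append ?prednK //.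
  by move/(_ (leqnn _)); rewrite /bump; case: ifP; lia.
rewrite ltnS leq_eqVlt => /orP[/eqP e|ltim]; last first.
  have := alt i ltim; rewrite !nth_append //; last exact: ltnW.
  by rewrite /bump; case: ifP; lia.
rewrite e nth_append_last nth_append -?e //; move: st.
by rewrite -e /= /bump; case: ifP; lia.
Qed.

Lemma has2143_append s c :
  ~ has2143 (append_value c s) <-> ~ has2143 s /\ open_slot s c.
Proof.
split=> [av|[av /open_slotP op]].
  split=> [[i [j [k [l [[ij jk kl lm] [ji il lk]]]]]]|].
    apply: av; exists i, j, k, l; rewrite size_append; split; first by split; lia.
    by rewrite !nth_append; try lia; rewrite /bump; split; lia.
  apply/open_slotP => i j k ij jk km ji ic; rewrite ltnNge; apply/negP=> ck; apply: av.
  exists i, j, k, (size s); rewrite size_append; split; first by split; lia.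
  by rewrite nth_append_last !nth_append; try lia; rewrite /bump; split; lia.
case=> i [j [k [l [[ij jk kl]]]]]; rewrite size_append ltnS leq_eqVlt => /orP[/eqP e|lm].
  subst l; rewrite nth_append_last !nth_append; try lia.
  move=> [ji ic ck]; have := op i j k ij jk kl; move: ji ic ck; rewrite /bump; lia.
move=> H; apply: av; exists i, j, k, l; split; first by split.
by move: H; rewrite !nth_append; try lia; rewrite /bump => -[*]; split; lia.
Qed.

Lemma card_alt_avoiding m :
  #|alt_avoiding m p2143| = extensions step2143 m [::].
Proof.
rewrite -(card_extensions (good := fun m (w : 'S_m) => alternating w && avoids w p2143)).
- by apply: eq_card => w; rewrite !inE.
- move=> w; apply/andP; split; first by apply/alternatingP=> i; rewrite size_word.
  by apply/containsP=> -[i [j [k [l [[_ _ _]]]]]]; rewrite size_word.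
move=> {}m w c; rewrite /step2143; apply/idP/idP.
  case/andP=> /alternatingP + /containsP; rewrite word_lift_perm.
  move=> /alternating_append[/alternatingP-> ->] /has2143_append[av ->].
  by rewrite !andbT; apply/containsP.
case/andP=> /andP[/alternatingP alt /containsP av] /andP[st op].
apply/andP; split.
  by apply/alternatingP; rewrite word_lift_perm; apply/alternating_append.
by apply/containsP; rewrite word_lift_perm; apply/has2143_append.
Qed.

(** * The least inversion top and the number of open slots *)

(* A word without inversions gets [t = size s]. *)
Definition least_inv_top (s : seq nat) (t : nat) : Prop :=
  [/\ t <= size s,
      forall i j, i < j -> j < size s -> nth 0 s j < nth 0 s i -> t <= nth 0 s i
    & t < size s -> exists i j,
        [/\ i < j, j < size s, nth 0 s j < nth 0 s i & nth 0 s i = t]].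

Definition onto_word (s : seq nat) : Prop :=
  forall v, v < size s -> exists2 i, i < size s & nth 0 s i = v.

Definition open_above (s : seq nat) (a : nat) : nat :=
  \sum_(a <= z < (size s).+1) open_slot s z.

Lemma onto_append s c : onto_word s -> c <= size s -> onto_word (append_value c s).
Proof.
move=> onto cs v; rewrite size_append => vs.
have [vc|cv|->] := ltngtP v c.
- have [i lti iv] := onto v (leq_trans vc cs); exists i; first exact: ltnW.
  by rewrite nth_append // iv /bump leqNgt vc.
- have [|i lti iv] := onto v.-1; first lia.
  by exists i; [exact: ltnW|rewrite nth_append // iv /bump; lia].
by exists (size s); rewrite ?nth_append_last.
Qed.

(** Every old value [>= c] becomes an inversion top, the least one being the old [c], now [c.+1]. If
    [t < c], the old top [t] is unmoved and remains least. *)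
Lemma least_inv_top_append s t c : onto_word s -> least_inv_top s t -> c <= size s ->
  least_inv_top (append_value c s) (if c <= t then c.+1 else t).
Proof.
move=> onto [ts top_ge top_ex] cs; split; rewrite ?size_append; first by case: ifP; lia.
  move=> i j ij; rewrite ltnS leq_eqVlt => /orP[/eqP ej|js].
    by subst j; rewrite nth_append_last nth_append // /bump; case: ifP; lia.
  have := top_ge i j ij js; rewrite !nth_append //; last exact: ltn_trans js.
  by rewrite /bump; case: ifP; lia.
have [ct|tc] := leqP c t => lts.
  have [|i lti ic] := onto c; first lia.
  exists i, (size s); rewrite nth_append_last nth_append // ic /bump; split; lia.
have [|i [j [ij js ji it]]] := top_ex; first lia.
have lti := ltn_trans ij js.
by exists i, j; rewrite !nth_append // /bump; split; lia.
Qed.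

Lemma open_slot_low s t x : least_inv_top s t -> x <= t -> open_slot s x.
Proof.
move=> [_ top_ge _] xt; apply/open_slotP => i j k ij jk ks ji.
by have := top_ge i j ij (ltn_trans jk ks) ji; lia.
Qed.

(** In a 213 the new last entry can only be the 3. It blocks a slot [x <= c] when some old inversion
    has its top below [x], that is, when [t < x]. *)
Lemma open_slot_append s t c x : least_inv_top s t -> c <= size s ->
  open_slot (append_value c s) x = open_slot s (unbump c x) && ~~ (t < x <= c).
Proof.
move=> [ts top_ge top_ex] cs; apply/open_slotP/andP => [op|[/open_slotP op txc] i j k].
  split; last first.
    apply/negP=> /andP[tx xc]; have [|i [j [ij js ji it]]] := top_ex; first lia.
    have lti := ltn_trans ij js.
    have := op i j (size s) ij js; rewrite size_append nth_append_last !nth_append //.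
    rewrite /bump; lia.
  apply/open_slotP => i j k ij jk ks.
  have js := ltn_trans jk ks; have lti := ltn_trans ij js.
  have := op i j k ij jk; rewrite size_append !nth_append //.
  by rewrite /bump /unbump; lia.
move=> ij jk; rewrite size_append ltnS leq_eqVlt => /orP[/eqP e|ks].
  subst k; have lti := ltn_trans ij jk; have := top_ge i j ij jk.
  by rewrite nth_append_last !nth_append // /bump; lia.
have js := ltn_trans jk ks; have lti := ltn_trans ij js.
have := op i j k ij jk ks; rewrite !nth_append //.
by rewrite /bump /unbump; lia.
Qed.

(** Slots up to [minn c t] are open, those after [t] and up to [c] are closed, and a slot [z.+1]
    above [c] behaves as the old slot [z]. *)
Lemma open_above_append s t c : least_inv_top s t -> c <= size s -> open_slot s c ->
  open_above (append_value c s) 0 = (minn c t).+1 + open_above s c.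
Proof.
move=> top cs oc; rewrite /open_above size_append.
rewrite (big_cat_nat (n := c.+1)) //=; last by rewrite ltnS leqW.
rewrite (big_cat_nat (n := (minn c t).+1)) //=; last by rewrite ltnS geq_minl.
rewrite [X in _ + X + _]big_nat_cond [X in _ + X + _]big1 => [|z /andP[/andP[lz zc] _]]; last first.
  by rewrite (open_slot_append _ top) //; case: ltnP => //=; rewrite ?andbF //; lia.
rewrite addn0 big_nat_cond (eq_bigr (fun=> 1)); last first.
  move=> z /andP[/andP[_ lz] _]; rewrite (open_slot_append _ top) //.
  have -> : unbump c z = z by rewrite /unbump; lia.
  by rewrite (open_slot_low top); lia.
rewrite -big_nat_cond sum_nat_const_nat muln1 subn0; congr (_ + _).
rewrite big_add1 /=; apply: eq_big_nat => z /andP[cz zs].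
rewrite (open_slot_append _ top) //; have -> : unbump c z.+1 = z by rewrite /unbump; lia.
by congr nat_of_bool; lia.
Qed.

Lemma open_above_low s t a : least_inv_top s t -> a <= t ->
  open_above s 0 = a + open_above s a.
Proof.
move=> top at_; have [ts _ _] := top.
rewrite /open_above (big_cat_nat (n := a)) //=; last lia.
congr (_ + _); rewrite big_nat_cond (eq_bigr (fun=> 1)); last first.
  by move=> z /andP[/andP[_ lz] _]; rewrite (open_slot_low top) //; lia.
by rewrite -big_nat_cond sum_nat_const_nat muln1 subn0.
Qed.

(* The summand depends on [x] only through the rank of [x], from the top, among
   the elements of [A]. *)
Lemma sum_by_rank (A : pred nat) (g : nat -> nat) a b :
  \sum_(a <= x < b | A x) g (\sum_(x <= z < b) A z) =
  \sum_(1 <= i < (\sum_(a <= z < b) A z).+1) g i.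
Proof.
case: (leqP b a) => [ba|/ltnW]; first by rewrite !big_geq.
move=> /subnKC <-; move: (b - a) => d.
elim: d a => [|d IH] a; first by rewrite addn0 !big_geq.
have ad : a < a + d.+1 by rewrite addnS ltnS leq_addr.
rewrite big_ltn_cond //.
have IHa := IH a.+1; rewrite addSnnS in IHa; rewrite {}IHa big_ltn //.
case: (A a); rewrite ?add0n // add1n [RHS]big_nat_recr //= addnC; congr (_ + g _).
Qed.

(** * The common recursion *)

(** Here [c] and [d] are the bottom and middle entries of a new column when appended; later entries
    of that column push them to [c.+2] and [d.+1]. The base case counts the places of the lone
    entry. *)
Fixpoint chains (r x y : nat) : nat :=
  if r is r'.+1 then
    \sum_(0 <= c < y.+1) \sum_(0 <= d < (minn c x).+1) chains r' d.+1 c.+2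
  else x.+1.

(** The same recursion stopped halfway through a step: [t] is already chosen, and the next [y] is
    bounded by [k]. *)
Definition chains_above (r t k : nat) : nat :=
  if r is r'.+1 then \sum_(t.+1 <= y < k.+1) chains r' t y else 1.

(** The double sum is exchanged, so that [d] is chosen first and [c] then runs from [d] to [y]. *)
Lemma chainsE r x y : x <= y ->
  chains r x y = \sum_(0 <= d < x.+1) chains_above r d.+1 y.+2.
Proof.
move=> xy; case: r => [|r] /=; first by rewrite sum_nat_const_nat muln1 subn0.
pose F c d := chains r d.+1 c.+2.
transitivity (\sum_(0 <= c < y.+1) \sum_(0 <= d < x.+1 | d <= c) F c d).
  apply: eq_big_nat => c /andP[_ cy].
  rewrite (big_nat_widen _ _ x.+1) ?ltnS ?geq_minr // big_nat_cond [RHS]big_nat_cond.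
  by apply: eq_bigl => d; lia.
rewrite (exchange_big_dep_nat xpredT) //=; apply: eq_big_nat => d /andP[_ dx].
rewrite big_add1 big_add1 /= [RHS](big_nat_widenl _ 0) //.
Qed.

(** * Alternating words of odd length follow the common recursion *)

Lemma extensions_step2143 r s t :
    onto_word s -> least_inv_top s t -> odd (size s) ->
    (nth 0 s (size s).-1).+1 = t ->
  extensions step2143 r.*2 s = chains_above r t (open_above s 0).
Proof.
elim: r s t => [//|r IH] s t onto top odd_s lastE.
have [ts _ _] := top.
have s_gt0 : size s > 0 by case: (size s) odd_s.
have stepE x : step2143 s x = open_slot s x && (t <= x).
  rewrite /step2143 /alternating_step.
  have -> : odd (size s).-1 = false by lia.
  by rewrite -lastE andbC; case: (size s) s_gt0.
(* After the ascent to [x] and any allowed descent, the number of open slots is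
   [t + open_above s x + 2]. *)
have inner x : t <= x <= size s -> open_slot s x ->
    extensions step2143 r.*2.+1 (append_value x s) = chains r t (t + open_above s x).
  move=> /andP[tx xs] ox; rewrite /= size_append.
  have top' := least_inv_top_append onto top xs.
  have onto' := onto_append onto xs.
  set s' := append_value x s in top' onto' *.
  set t' := if _ then _ else _ in top'.
  have tt' : t <= t' by rewrite /t'; case: ifP; lia.
  (* A descent needs [y <= x]; the ascent has closed the slots after [t] up to [x], and all slots up
     to [t] are open. *)
  have step'E y : step2143 s' y = (y < t.+1).
    rewrite /step2143 /alternating_step size_append /= odd_s nth_append_last.
    rewrite (open_slot_append _ top) //; case: (leqP y x) => [yx|]; last lia.
    have -> : unbump x y = y by rewrite /unbump; lia.
    rewrite /= ltnS; case: (leqP y t) => [yt|] /=; last by rewrite andbF.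
    by rewrite (open_slot_low top).
  rewrite chainsE ?leq_addr // [RHS](big_nat_widen _ _ (size s).+2); last lia.
  rewrite (eq_bigl _ _ step'E) [LHS]big_nat_cond [RHS]big_nat_cond.
  apply: eq_bigr => y /andP[_]; rewrite ltnS => yt.
  have yt' := leq_trans yt tt'.
  have ys' : y <= size s' by rewrite size_append; lia.
  rewrite (IH _ y.+1).
  - rewrite (open_above_append top') ?(open_slot_low top') //.
    have -> : minn y t' = y by lia.
    rewrite addSn -(open_above_low top') // (open_above_append top) //.
    by have -> : minn x t = t by lia.
  - exact: onto_append.
  - by have := least_inv_top_append onto' top' ys'; rewrite yt'.
  - by rewrite !size_append /= odd_s.
  - by rewrite !size_append -(size_append x s) nth_append_last.
rewrite doubleS [LHS]/=.
under eq_bigl do rewrite stepE.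
rewrite -(big_nat_widenl t 0) //.
rewrite big_nat_cond (eq_bigr (fun x => chains r t (t + open_above s x))); last first.
  by move=> x /andP[/andP[tx xs] ox]; rewrite -inner ?tx.
(* Only the rank of [x] among the open slots matters; the ranks fill an interval starting at 1. *)
rewrite -big_nat_cond (sum_by_rank (open_slot s) (fun i => chains r t (t + i))).
rewrite (open_above_low top (leqnn t)) /= -[t.+1]add1n big_addn -addnS addKn.
by apply: eq_bigr => i _; rewrite addnC.
Qed.

Lemma card_alt_avoiding_odd n :
  #|alt_avoiding (2 * n + 1) p2143| = chains n 0 0.
Proof.
have open0 x : open_slot [:: 0] x.
  by apply/open_slotP=> i [|j] [|k].
have step0 : step2143 [::] 0 by apply/open_slotP => i j [].
rewrite card_alt_avoiding addn1 mul2n /= big_mkcond big_nat1 step0.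
(* The word [[:: 0]] has no inversion, so [t] is its size 1, and both its slots are open. *)
rewrite (@extensions_step2143 _ _ 1) //.
- rewrite /open_above big_nat_recl // big_nat1 !open0.
  by case: n => [|n] /=; rewrite ?big_nat1.
- by case=> // _; exists 0.
by split=> // i [|j].
Qed.

(** * Shifted tableaux as words *)

(* Step [i] of the reading fills the box in row [2 - v %% 3] and column
   [n + 1 - v %/ 3], where [v = cell_code n i]; the jumps at [3 * n] and
   [3 * n + 2] skip the boxes missing from the first two columns. *)
Definition cell_code (n i : nat) : nat :=
  if i < 3 * n then i else if i < (3 * n).+2 then i.+1 else i + 3.

Definition aligned (n i j : nat) : bool :=
  (cell_code n i == cell_code n j %[mod 3]) || (cell_code n i %/ 3 == cell_code n j %/ 3).

(** The reading goes leftwards and upwards, so within a row or column of a tableau the later entry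
    is the smaller one. *)
Definition decreasing_aligned (n m : nat) (w : 'S_m) : bool :=
  [forall i : 'I_m, forall j : 'I_m, (i < j) && aligned n i j ==> (w j < w i)].

Definition aligned_step (n : nat) (s : seq nat) (c : nat) : bool :=
  [forall i : 'I_(size s), aligned n i (size s) ==> (c <= nth 0 s i)].

Lemma aligned_stepP n s c : reflect
  (forall i, i < size s -> aligned n i (size s) -> c <= nth 0 s i) (aligned_step n s c).
Proof.
apply: (iffP forallP) => [H i lti|H i]; last by apply/implyP/H.
by have /implyP := H (Ordinal lti).
Qed.

Lemma card_decreasing_aligned n m :
  #|[set w : 'S_m | decreasing_aligned n w]| = extensions (aligned_step n) m [::].
Proof.
apply: (card_extensions (good := fun m (w : 'S_m) => decreasing_aligned n w)).
  by move=> w; apply/forallP=> -[].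
move=> {}m w c; apply/forallP/andP => [dec|[/forallP dec /aligned_stepP st] i].
  split.
    apply/forallP=> i; apply/forallP=> j; apply/implyP=> ij.
    have /forallP/(_ (lift ord_max j)) := dec (lift ord_max i).
    rewrite !lift_max ij !lift_perm_lift /= /bump; lia.
  apply/aligned_stepP => i; rewrite size_word => lti al.
  have /forallP/(_ ord_max) := dec (lift ord_max (Ordinal lti)).
  rewrite lift_max /= lti al lift_perm_lift lift_perm_id /=.
  by rewrite -(nth_word w (Ordinal lti)) /= /bump; lia.
apply/forallP=> j; apply/implyP; case: (unliftP ord_max i) => [i'|] ->; last first.
  by case/andP=> /=; have := ltn_ord j; lia.
case: (unliftP ord_max j) => [j'|] ->.
  rewrite !lift_max !lift_perm_lift /= => ij.
  by have /forallP/(_ j')/implyP/(_ ij) := dec i'; rewrite /bump; lia.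
rewrite lift_max lift_perm_lift lift_perm_id /= => /andP[_ al].
by have := st i'; rewrite size_word nth_word al ltn_ord /bump => /(_ isT isT); lia.
Qed.

(** * Words of tableaux follow the common recursion *)

Lemma sum_nat_initial (P : pred nat) (F : nat -> nat) a b :
  a <= b -> (forall c, c < b -> P c = (c < a)) ->
  \sum_(0 <= c < b | P c) F c = \sum_(0 <= c < a) F c.
Proof.
move=> ab PE; rewrite [RHS](big_nat_widen _ _ b) // big_nat_cond [RHS]big_nat_cond.
by apply: eq_bigl => c; case: ltnP => //= cb; rewrite PE.
Qed.

(* Bottom boxes are read at steps [0 mod 3] and middle boxes at steps [1 mod 3];
   [y] and [x] are the least values so far in these rows, and [0] before the
   first column. *)
Definition column_state (s : seq nat) (x y : nat) : Prop :=
  [/\ x <= size s /\ y <= size s,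
      forall z, z <= size s ->
        z <= y <-> (forall i, i < size s -> i %% 3 = 0 -> z <= nth 0 s i),
      forall z, z <= size s ->
        z <= x <-> (forall i, i < size s -> i %% 3 = 1 -> z <= nth 0 s i)
    & 0 < x -> 0 < size s /\ nth 0 s (size s).-1 = 0].

Lemma nth_append2 c d s i : i < (size s).+1 ->
  nth 0 (append_value d (append_value c s)) i = bump d (nth 0 (append_value c s) i).
Proof. by rewrite -(size_append c) => /nth_append. Qed.

Lemma nth_append2_last c d s :
  nth 0 (append_value d (append_value c s)) (size s).+1 = d.
Proof. by rewrite -(size_append c) nth_append_last. Qed.

Lemma extensions_aligned_step n r k s x y :
    k + r = n -> size s = 3 * k -> column_state s x y ->
  extensions (aligned_step n) (3 * r + 3) s = chains r x y.
Proof.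
elim: r k s x y => [|r IH] k s x y krn sk [[xs ys] yP xP lastP].
  (* Three boxes remain: the lone middle one, with [x.+1] choices, and two in the top row, whose
     appended values must be 0. *)
  have a1 c : c < (size s).+1 -> aligned_step n s c = (c < x.+1).
    move=> cs; rewrite ltnS; apply/aligned_stepP/idP => [H|/xP H i lti al].
      apply/xP => // i lti i1; apply: H => //.
      rewrite /aligned /cell_code; repeat case: ifP; lia.
    apply: H => //; move: al; rewrite /aligned /cell_code; repeat case: ifP; lia.
  rewrite /= (sum_nat_initial _ _ a1) // big_nat_cond (eq_bigr (fun=> 1)).
    by rewrite -big_nat_cond sum_nat_const_nat muln1 subn0.
  move=> c /andP[/andP[_ cx] _]; rewrite size_append.
  rewrite (@sum_nat_initial _ _ 1) ?big_nat1 // => [|d ds].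
    rewrite !size_append (@sum_nat_initial _ _ 1) ?big_nat1 // => e es.
    rewrite ltnS leqn0; apply/aligned_stepP/eqP => [|-> //].
    move/(_ (size s).+1); rewrite !size_append nth_append2_last.
    move=> H; apply/eqP; rewrite -leqn0; apply: H => //.
    rewrite /aligned /cell_code; repeat case: ifP; lia.
  rewrite ltnS leqn0; apply/aligned_stepP/eqP => [H|-> //].
  have dc : d <= c.
    have := H (size s); rewrite size_append nth_append_last; apply=> //.
    rewrite /aligned /cell_code; repeat case: ifP; lia.
  (* If [c > 0], the old top entry keeps its value 0, which forces [d = 0]. *)
  case: (posnP c) => [|c0]; first lia.
  have [|s0 l0] := lastP; first lia.
  have := H (size s).-1; rewrite size_append nth_append ?prednK // l0.
  rewrite /aligned /cell_code /bump; repeat case: ifP; lia.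
have aE i j : i < j -> j < 3 * n -> aligned n i j = (i == j %[mod 3]) || (i %/ 3 == j %/ 3).
  by move=> ij jn; rewrite /aligned /cell_code !ifT //; lia.
have kn : k < n by lia.
have a1 c : c < (size s).+1 -> aligned_step n s c = (c < y.+1).
  move=> cs; rewrite ltnS; apply/aligned_stepP/idP => [H|/yP H i lti al].
    by apply/yP => // i lti i1; apply: H => //; rewrite aE; lia.
  by apply: H => //; move: al; rewrite aE; lia.
(* Once [d <= c], shifting the middle row by [c] does not affect whether [d] lies below its
   entries. *)
have a2 c d : c <= y -> d < (size s).+2 ->
    aligned_step n (append_value c s) d = (d < (minn c x).+1).
  move=> cy ds; rewrite ltnS leq_min; apply/aligned_stepP/andP => [H|[dc dx] i].
    have dc : d <= c.
      have := H (size s); rewrite size_append nth_append_last; apply=> //.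
      by rewrite aE; lia.
    split=> //; apply/xP; first lia.
    move=> i lti i1; have := H i; rewrite size_append nth_append // aE; try lia.
    by rewrite /bump; lia.
  rewrite size_append ltnS leq_eqVlt => /orP[/eqP->|lti]; first by rewrite nth_append_last.
  rewrite aE; [|lia..]; rewrite nth_append // => al.
  have /xP/(_ i lti) := dx; rewrite /bump; lia.
have a3 c d e : c <= y -> d <= minn c x -> e < (size s).+3 ->
    aligned_step n (append_value d (append_value c s)) e = (e < 1).
  rewrite leq_min => cy /andP[dc dx] es.
  rewrite ltnS leqn0; apply/aligned_stepP/eqP => [H|-> //].
  have ed : e <= d.
    have := H (size s).+1; rewrite !size_append nth_append2_last; apply=> //.
    by rewrite aE; lia.
  (* If [d > 0], then [x > 0], so the previous top entry is 0; neither [c] nor [d] moves it, which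
     forces [e = 0]. *)
  case: (posnP d) => [|d0]; first lia.
  have [|s0 l0] := lastP; first lia.
  have := H (size s).-1; rewrite !size_append nth_append2 ?nth_append; try lia.
  by rewrite l0 aE /bump; lia.
have -> : 3 * r.+1 + 3 = (3 * r + 3).+3 by lia.
rewrite [LHS]/= (sum_nat_initial _ _ a1) //; apply: eq_big_nat => c /andP[_ cy].
rewrite size_append (sum_nat_initial _ _ (fun d => a2 c d cy)); last lia.
apply: eq_big_nat => d /andP[_ dcx].
rewrite !size_append (sum_nat_initial _ _ (fun e => a3 c d e cy dcx)) // big_nat1.
move: dcx; rewrite ltnS leq_min => /andP[dc dx].
set s3 := append_value 0 _.
have sz3 : size s3 = (size s).+3 by rewrite !size_append.
have n3 i : i < size s -> nth 0 s3 i = (bump d (bump c (nth 0 s i))).+1.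
  move=> lti; rewrite nth_append ?size_append; last lia.
  by rewrite nth_append2 ?nth_append //; lia.
(* As [d <= c], both later values push [c] up, whereas [d] is pushed only by the final 0. *)
have n30 : nth 0 s3 (size s) = c.+2.
  rewrite nth_append ?size_append ?nth_append2 ?nth_append_last //.
  by rewrite /bump; lia.
have n31 : nth 0 s3 (size s).+1 = d.+1.
  by rewrite nth_append ?size_append ?nth_append2_last.
have n32 : nth 0 s3 (size s).+2 = 0.
  by rewrite -(size_append c) nth_append2_last.
apply: (IH k.+1); [lia|rewrite sz3; lia|split; rewrite ?sz3].
- lia.
- move=> z zs; split=> [zc i|H]; last by rewrite -n30; apply: H; lia.
  rewrite ltnS leq_eqVlt => /orP[/eqP->|]; first by rewrite sk; lia.
  rewrite ltnS leq_eqVlt => /orP[/eqP->|]; first by rewrite sk; lia.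
  rewrite ltnS leq_eqVlt => /orP[/eqP->|lti i0]; first by rewrite n30.
  have /(yP y ys).1/(_ i lti i0) := leqnn y; rewrite n3 // /bump; lia.
- move=> z zs; split=> [zc i|H]; last by rewrite -n31; apply: H; lia.
  rewrite ltnS leq_eqVlt => /orP[/eqP->|]; first by rewrite sk; lia.
  rewrite ltnS leq_eqVlt => /orP[/eqP->|]; first by rewrite n31.
  rewrite ltnS leq_eqVlt => /orP[/eqP->|lti i0]; first by rewrite sk; lia.
  have /(xP x xs).1/(_ i lti i0) := leqnn x; rewrite n3 // /bump; lia.
by rewrite n32.
Qed.

Lemma card_decreasing_aligned_chains n :
  #|[set w : 'S_(3 * n + 3) | decreasing_aligned n w]| = chains n 0 0.
Proof.
by rewrite card_decreasing_aligned; apply: (@extensions_aligned_step _ _ 0).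
Qed.

(** * Boxes of the shifted shape in reading order *)

Definition trapezoid (n : nat) : seq nat := [:: n + 2; n + 1; n].

(** The inverse of [cell_code] on boxes; the skipped codes are [3 * n], [3 * n + 3] and
    [3 * n + 4]. *)
Definition cell_index (n : nat) (b : box (trapezoid n)) : nat :=
  let v := 3 * (n + 1 - box_col b) + (2 - box_row b) in
  if v < 3 * n then v else if v < (3 * n).+3 then v.-1 else v - 3.

Lemma box_bounds n (b : box (trapezoid n)) :
  [/\ box_row b < 3, box_row b <= box_col b & box_col b <= n + 1].
Proof.
rewrite /box_row /box_col leq_addr ltn_ord; split=> //.
by case: b => [[[|[|[|?]]] ?] [k /=]] //; lia.
Qed.

Lemma box_eq la (b c : box la) :
  box_row b = box_row c -> box_col b = box_col c -> b = c.
Proof.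
case: b c => [i k] [j l]; rewrite /box_row /box_col /= => /val_inj ij; subst j.
by move=> /addnI /val_inj ->.
Qed.

Lemma cell_indexK n (b : box (trapezoid n)) :
  cell_code n (cell_index b) = 3 * (n + 1 - box_col b) + (2 - box_row b).
Proof.
have [r3 rc cn] := box_bounds b; rewrite /cell_code /cell_index.
repeat case: ifP; lia.
Qed.

Lemma cell_index_lt n (b : box (trapezoid n)) : cell_index b < sumn (trapezoid n).
Proof.
have [r3 rc cn] := box_bounds b; rewrite /cell_index /=.
repeat case: ifP; lia.
Qed.

Lemma ltn_cell_code n i j : (cell_code n i < cell_code n j) = (i < j).
Proof. by rewrite /cell_code; repeat case: ifP; lia. Qed.

Lemma ltn_cell_index n (b c : box (trapezoid n)) :
  (cell_index b < cell_index c) = 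
  (box_col c < box_col b) || (box_col b == box_col c) && (box_row c < box_row b).
Proof.
have [r3 rc cn] := box_bounds b; have [r3' rc' cn'] := box_bounds c.
rewrite -(ltn_cell_code n) !cell_indexK; lia.
Qed.

Lemma aligned_cell_index n (b c : box (trapezoid n)) :
  aligned n (cell_index b) (cell_index c) =
  (box_row b == box_row c) || (box_col b == box_col c).
Proof.
have [r3 rc cn] := box_bounds b; have [r3' rc' cn'] := box_bounds c.
rewrite /aligned !cell_indexK; lia.
Qed.

Lemma card_box la : #|box la| = sumn la.
Proof.
rewrite card_tagged; congr sumn.
rewrite (eq_map (g := fun i : 'I_(size la) => nth 0 la i)); last by move=> i; rewrite card_ord.
by rewrite (map_comp (nth 0 la) val) val_enum_ord map_nth_iota0 // take_size.
Qed.

Definition box_ord n (b : box (trapezoid n)) : 'I_(sumn (trapezoid n)) :=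
  Ordinal (cell_index_lt b).

Lemma box_ord_bij n : bijective (@box_ord n).
Proof.
apply: inj_card_bij => [b c /(congr1 val) /= bc|]; last by rewrite card_ord card_box.
have : ~~ (cell_index b < cell_index c) && ~~ (cell_index c < cell_index b).
  by rewrite bc ltnn.
by rewrite !ltn_cell_index => H; apply: (@box_eq (trapezoid n)); lia.
Qed.

Lemma card_shifted_SYT_trapezoid n :
  #|shifted_SYT (trapezoid n)| =
  #|[set w : 'S_(sumn (trapezoid n)) | decreasing_aligned n w]|.
Proof.
pose tableau (w : 'S_(sumn (trapezoid n))) := [ffun b => w (@box_ord n b)].
have [ord_box boxK ordK] := box_ord_bij n.
have tab_inj : injective tableau.
  move=> w v /ffunP e; apply/permP=> i.
  by have := e (ord_box i); rewrite !ffunE ordK.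
rewrite -(card_imset _ tab_inj); apply: eq_card => T; rewrite !inE.
apply/and3P/imsetP => [[/forallP bijT /forallP rowT /forallP colT]|[w]].
  have injT : injective (fun i => T (ord_box i)).
    move=> i j e; apply: (can_inj ordK).
    have /cards1P[b /setP eb] := bijT (T (ord_box i)).
    have := eb (ord_box i); have := eb (ord_box j); rewrite !inE e eqxx.
    by move=> /esym/eqP-> /esym/eqP->.
  exists (perm injT); last by apply/ffunP=> b; rewrite ffunE permE boxK.
  rewrite inE; apply/forallP=> i; apply/forallP=> j; apply/implyP.
  rewrite !permE -{1 2}(ordK i) -{1 2}(ordK j).
  move: (ord_box i) (ord_box j) => b c /=; rewrite aligned_cell_index ltn_cell_index.
  have /forallP/(_ b)/implyP r := rowT c; have /forallP/(_ b)/implyP cl := colT c.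
  (* The box [b], read earlier, lies to the right of [c] in its row or below it in its column. *)
  by case/andP=> H1 H2; case: (eqVneq (box_row b) (box_row c)) => e; [apply: r|apply: cl]; lia.
rewrite inE => /forallP dec ->.
have decP b c : cell_index b < cell_index c -> aligned n (cell_index b) (cell_index c) ->
    w (box_ord c) < w (box_ord b).
  by move=> bc al; have /forallP/(_ (box_ord c))/implyP := dec (box_ord b); rewrite /= bc al; apply.
split.
- apply/forallP=> e; apply/cards1P; exists (ord_box (w^-1 e)%g).
  apply/setP=> b; rewrite !inE ffunE.
  by apply/eqP/eqP => [<-|->]; rewrite ?permK ?boxK ?ordK ?permKV.
- apply/forallP=> b; apply/forallP=> c; apply/implyP=> /andP[/eqP r cl]; rewrite !ffunE.
  by apply: decP; rewrite ?ltn_cell_index ?aligned_cell_index ?r ?cl ?eqxx.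
apply/forallP=> b; apply/forallP=> c; apply/implyP=> /andP[/eqP cl r]; rewrite !ffunE.
by apply: decP; rewrite ?ltn_cell_index ?aligned_cell_index ?r ?cl ?eqxx ?orbT.
Qed.

Theorem mainTheorem2 (n : nat) :
  #|alt_avoiding (2 * n + 1) p2143| = #|shifted_SYT [:: n + 2; n + 1; n]|.
Proof.
(* With both cardinals written as [extensions], the lengths [3 * n + 3] and [sumn (trapezoid n)] are
   compared as numbers, without a cast between permutation types. *)
rewrite card_alt_avoiding_odd -card_decreasing_aligned_chains !card_decreasing_aligned.
rewrite (card_shifted_SYT_trapezoid n) card_decreasing_aligned.
by congr extensions; rewrite /=; lia.
Qed.
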